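(* Let $N \ge 1$ and let $\mathbf{L} \in \mathbb{R}^{N\times N}$ be a difference matrix, i.e. (i) $\mathbf{L}$ is symmetric and has rank $N-1$, and (ii) $\mathbf{L}\mathbf{1} = \mathbf{0}$, where $\mathbf{1} = (1,\ldots,1)^T \in \mathbb{R}^N$. Let $\mathbf{J}$ be the $N \times N$ matrix all of whose entries equal $1$. Then for every $\tau \in \mathbb{R}\setminus\{0\}$ the matrix $\mathbf{L}-\tau\mathbf{J}$ is invertible and the Moore-Penrose inverse of $\mathbf{L}$ is $$\mathbf{L}^{+} = (\mathbf{L} - \tau \mathbf{J})^{-1} + \frac{1}{\tau N^2}\,\mathbf{J}.$$ In particular, the right-hand side does not depend on the choice of $\tau$. Further, $\mathbf{L}^+$ is symmetric.
   Context: The Moore-Penrose inverse of a real square matrix $\mathbf{L}$ is the unique matrix $\mathbf{L}^+$ such that $\mathbf{L}\mathbf{L}^+\mathbf{L} = \mathbf{L}$, $\mathbf{L}^+\mathbf{L}\mathbf{L}^+ = \mathbf{L}^+$, and both $\mathbf{L}\mathbf{L}^+$ and $\mathbf{L}^+\mathbf{L}$ are symmetric. *)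

(* Defs.v *)
From mathcomp Require Import all_boot all_order all_algebra.
From mathcomp Require Import reals.

Set Implicit Arguments.
Unset Strict Implicit.
Unset Printing Implicit Defensive.

Import Order.TTheory GRing.Theory Num.Theory.
Local Open Scope ring_scope.

(* Meant for N >= 1: the predecessor is truncated, so for N = 0 the empty
   matrix would qualify. *)
Definition difference_matrix (R : realType) (N : nat) (L : 'M[R]_N) : Prop :=
  [/\ L^T = L, \rank L = N.-1 & L *m const_mx 1 = 0 :> 'cV[R]_N].

Definition is_moore_penrose (R : realType) (N : nat) (L X : 'M[R]_N) : bool :=
  [&& L *m X *m L == L,
      X *m L *m X == X,
      (L *m X)^T == L *m X &
      (X *m L)^T == X *m L].

Lemma is_moore_penrose_unique (R : realType) (N : nat) (L X Y : 'M[R]_N) :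
  is_moore_penrose L X -> is_moore_penrose L Y -> X = Y.
Proof.
case/and4P=> /eqP LXL /eqP XLX /eqP LXs /eqP XLs.
case/and4P=> /eqP LYL /eqP YLY /eqP LYs /eqP YLs.
have LXY : L *m X = L *m Y.
  by rewrite -{1}LYL -(mulmxA (L *m Y)) -LXs -LYs -trmx_mul (mulmxA (L *m X)) LXL.
have XLY : X *m L = Y *m L.
  rewrite -{1}LYL -(mulmxA L) mulmxA -XLs -YLs -trmx_mul.
  by rewrite -(mulmxA Y) (mulmxA L) LXL.
by rewrite -XLX -mulmxA LXY mulmxA XLY YLY.
Qed.

Lemma row_free_gram_unit (R : realType) (m n : nat) (C : 'M[R]_(m, n)) :
  row_free C -> C *m C^T \in unitmx.
Proof.
move=> Cfree; rewrite -row_free_unit -kermx_eq0; apply/eqP/row_matrixP => i; rewrite row0.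
set u := row i _.
have uCC : u *m (C *m C^T) = 0 by rewrite /u -row_mul mulmx_ker row0.
have uC0 : u *m C = 0.
  have s0 : \sum_j (u *m C) 0 j ^+ 2 = 0.
    transitivity ((u *m (C *m C^T) *m u^T) 0 0); last by rewrite uCC mul0mx mxE.
    rewrite mulmxA -mulmxA -trmx_mul [RHS]mxE.
    by apply: eq_bigr => j _; rewrite [_^T _ _]mxE -expr2.
  apply/rowP => j; rewrite [RHS]mxE.
  have /psumr_eq0P : forall k, true -> 0 <= (u *m C) 0 k ^+ 2.
    by move=> k _; apply: sqr_ge0.
  by move=> /(_ s0 j isT) /eqP; rewrite sqrf_eq0 => /eqP.
by apply: (row_free_inj Cfree); rewrite uC0 mul0mx.
Qed.

Lemma moore_penrose_exists (R : realType) (N : nat) (L : 'M[R]_N) :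
  exists X : 'M[R]_N, is_moore_penrose L X.
Proof.
have [r [B [C [LBC Bt Cf]]]] : exists r (B : 'M[R]_(N, r)) (C : 'M[R]_(r, N)),
    [/\ L = B *m C, row_free B^T & row_free C].
  exists (\rank L), (col_base L), (row_base L); split.
  - by rewrite mulmx_base.
  - by rewrite /row_free mxrank_tr; apply: col_base_full.
  - exact: row_base_free.
have Cu := row_free_gram_unit Cf.
have := row_free_gram_unit Bt; rewrite trmxK => Bu.
pose P := invmx (C *m C^T); pose Q := invmx (B^T *m B).
have Ps : P^T = P by rewrite /P trmx_inv trmx_mul trmxK.
have Qs : Q^T = Q by rewrite /Q trmx_inv trmx_mul trmxK.
pose X := C^T *m P *m (Q *m B^T).
have LX : L *m X = B *m Q *m B^T.
  rewrite LBC /X -(mulmxA B) (mulmxA C) (mulmxA C) mulmxV // mul1mx.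
  by rewrite mulmxA.
have XL : X *m L = C^T *m P *m C.
  rewrite LBC /X -(mulmxA (C^T *m P)) (mulmxA (Q *m B^T)) -(mulmxA Q) mulVmx //.
  by rewrite mul1mx.
exists X; apply/and4P; split; apply/eqP.
- rewrite LX {1}LBC -!mulmxA (mulmxA B^T) (mulmxA Q) mulVmx // mul1mx.
  by rewrite -LBC.
- by rewrite XL /X -!mulmxA (mulmxA C) (mulmxA (C *m C^T)) mulmxV // mul1mx.
- by rewrite LX !trmx_mul trmxK Qs mulmxA.
- by rewrite XL !trmx_mul trmxK Ps mulmxA.
Qed.

Definition moore_penrose (R : realType) (N : nat) (L : 'M[R]_N) : 'M[R]_N :=
  xchoose (moore_penrose_exists L).

Lemma moore_penroseP (R : realType) (N : nat) (L X : 'M[R]_N) :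
  reflect (moore_penrose L = X) (is_moore_penrose L X).
Proof.
have mpL : is_moore_penrose L (moore_penrose L) by apply: xchooseP.
by apply: (iffP idP) => [/(is_moore_penrose_unique mpL)|<-].
Qed.

(* Main.v *)
Require Import Defs.
From mathcomp Require Import all_boot all_order all_algebra.
From mathcomp Require Import reals.

Set Implicit Arguments.
Unset Strict Implicit.
Unset Printing Implicit Defensive.

Import Order.TTheory GRing.Theory Num.Theory.
Local Open Scope ring_scope.

(* The kernel of L is the line spanned by 1, which J = 1 1^T scales by N; hence
   M = L - tau J is invertible.  Since J M = M J = - tau N J, we also know
   J M^-1 = M^-1 J = - (tau N)^-1 J, so that Y = M^-1 + (tau N^2)^-1 J satisfies
   L Y = Y L = 1 - J / N, the orthogonal projection onto the range of L, and
   Y J = 0. *)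

(** Transposition reverses products: the first two equations keep their shape, while the two
    symmetry conditions trade places. *)
Lemma is_moore_penrose_tr (R : realType) (N : nat) (L X : 'M[R]_N) :
  is_moore_penrose L X -> is_moore_penrose L^T X^T.
Proof.
case/and4P=> /eqP LXL /eqP XLX /eqP LXs /eqP XLs.
by apply/and4P; split; rewrite -!trmx_mul ?LXs ?XLs ?mulmxA ?LXL ?XLX.
Qed.

Lemma moore_penrose_tr (R : realType) (N : nat) (L : 'M[R]_N) :
  (moore_penrose L)^T = moore_penrose L^T.
Proof.
by apply/esym/moore_penroseP/is_moore_penrose_tr/moore_penroseP.
Qed.

Lemma mul_const_mx1 (R : pzSemiRingType) (m n p : nat) :
  (const_mx 1 : 'M[R]_(m, n)) *m (const_mx 1 : 'M[R]_(n, p))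
  = n%:R *: const_mx 1.
Proof.
apply/matrixP => i j; rewrite !mxE mulr1.
under eq_bigr do rewrite !mxE mulr1.
by rewrite sumr_const card_ord.
Qed.

(** By rank-nullity the left kernel of [L] has dimension 1. Symmetry of [L] puts the nonzero
    all-ones row in it, so that row spans it. *)
Lemma difference_matrix_ker (R : realType) (N : nat) (L : 'M[R]_N)
    (u : 'rV[R]_N) :
  (0 < N)%N -> difference_matrix L -> u *m L = 0 ->
  (u <= (const_mx 1 : 'rV[R]_N))%MS.
Proof.
move=> N0 [Ls rL L1] uL.
have eL : (const_mx 1 : 'rV[R]_N) *m L = 0.
  by apply: trmx_inj; rewrite trmx_mul trmx_const Ls L1 trmx0.
have e0 : (const_mx 1 : 'rV[R]_N) != 0.
  by apply/eqP => /rowP/(_ (Ordinal N0))/eqP; rewrite !mxE oner_eq0.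
have eK : ((const_mx 1 : 'rV[R]_N) <= kermx L)%MS by apply/sub_kermxP.
have [_] := mxrank_leqif_sup eK.
(* An inclusion of row spaces reverses when the ranks agree. Both are 1 here; [N - (N - 1) = 1] in
   truncated subtraction uses [0 < N]. *)
rewrite mxrank_ker rL rank_rV e0 -subn1 subKn // eqxx => /esym.
by apply: submx_trans; apply/sub_kermxP.
Qed.

Section Shift.
Variables (R : realType) (N : nat) (L : 'M[R]_N) (tau : R).
Hypotheses (N_gt0 : (0 < N)%N) (dL : difference_matrix L) (tau0 : tau != 0).

Local Notation J := (const_mx 1 : 'M[R]_N).
Local Notation M := (L - tau *: J).

Let N0 : N%:R != 0 :> R. Proof. by rewrite pnatr_eq0 -lt0n. Qed.

Lemma difference_matrix_mulJ : L *m J = 0.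
Proof.
case: dL => _ _ L1.
have -> : J = (const_mx 1 : 'cV[R]_N) *m (const_mx 1 : 'rV[R]_N).
  by rewrite mul_const_mx1 scale1r.
by rewrite mulmxA L1 mul0mx.
Qed.

Lemma difference_matrix_Jmul : J *m L = 0.
Proof.
case: (dL) => Ls _ _; apply: trmx_inj.
by rewrite trmx_mul trmx_const Ls difference_matrix_mulJ trmx0.
Qed.

Lemma shift_mulJ : M *m J = (- (tau * N%:R)) *: J.
Proof.
rewrite mulmxBl difference_matrix_mulJ -scalemxAl mul_const_mx1 scalerA.
by rewrite sub0r scaleNr.
Qed.

Lemma shift_Jmul : J *m M = (- (tau * N%:R)) *: J.
Proof.
rewrite mulmxBr difference_matrix_Jmul -scalemxAr mul_const_mx1 scalerA.
by rewrite sub0r scaleNr.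
Qed.

Let tauN0 : - (tau * N%:R) != 0. Proof. by rewrite oppr_eq0 mulf_neq0. Qed.

Lemma shift_unitmx : M \in unitmx.
Proof.
rewrite -row_free_unit -kermx_eq0; apply/eqP/row_matrixP => i; rewrite row0.
have : row i (kermx M) *m M = 0 by rewrite -row_mul mulmx_ker row0.
move: (row i _) => u uM.
(* [M J] is a nonzero multiple of [J], so [u M = 0] kills [u J], and then [u L = u M + tau u J] as
   well. *)
have uJ : u *m J = 0.
  apply: (scalerI tauN0).
  by rewrite scalemxAr -shift_mulJ mulmxA uM mul0mx scaler0.
have uL : u *m L = 0.
  by rewrite -(subrK (tau *: J) L) mulmxDr uM -scalemxAr uJ scaler0 addr0.
have /sub_rVP [c uE] := difference_matrix_ker N_gt0 dL uL.
(* Now [u] is [c] times the all-ones row, and each entry of [u J = 0] reads [c N = 0]. *)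
move: uJ; rewrite uE -scalemxAl mul_const_mx1 => /rowP/(_ (Ordinal N_gt0))/eqP.
by rewrite !mxE mulr1 mulf_eq0 (negPf N0) orbF => /eqP ->; rewrite scale0r.
Qed.

Lemma shift_invJ : invmx M *m J = (- (tau * N%:R))^-1 *: J.
Proof.
apply: (scalerI tauN0); rewrite scalerA divff // scale1r scalemxAr -shift_mulJ.
by rewrite mulKmx // shift_unitmx.
Qed.

Lemma shift_Jinv : J *m invmx M = (- (tau * N%:R))^-1 *: J.
Proof.
apply: (scalerI tauN0); rewrite scalerA divff // scale1r scalemxAl -shift_Jmul.
by rewrite mulmxK // shift_unitmx.
Qed.

Lemma difference_matrix_moore_penrose :
  is_moore_penrose L (invmx M + (tau * N%:R ^+ 2)^-1 *: J).
Proof.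
set Y := invmx M + _.
have tauV : tau * (- (tau * N%:R))^-1 = - N%:R^-1.
  by rewrite invrN mulrN invfM mulrA divff // mul1r.
have LY : L *m Y = 1%:M - N%:R^-1 *: J.
  rewrite mulmxDr -scalemxAr difference_matrix_mulJ scaler0 addr0.
  (* Only the [L] outside the inverse is expanded as [M + tau J], giving
     [L M^-1 = 1 + tau J M^-1]. *)
  rewrite -{1}(subrK (tau *: J) L) mulmxDl mulmxV ?shift_unitmx //.
  by rewrite -scalemxAl shift_Jinv scalerA tauV scaleNr.
have YL : Y *m L = 1%:M - N%:R^-1 *: J.
  rewrite mulmxDl -scalemxAl difference_matrix_Jmul scaler0 addr0.
  rewrite -{2}(subrK (tau *: J) L) mulmxDr mulVmx ?shift_unitmx //.
  by rewrite -scalemxAr shift_invJ scalerA tauV scaleNr.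
(* This explains the coefficient of [J] in [Y]: [(tau N^2)^-1 J J = (tau N)^-1 J] cancels
   [M^-1 J]. *)
have YJ : Y *m J = 0.
  rewrite mulmxDl shift_invJ -scalemxAl mul_const_mx1 scalerA -scalerDl.
  rewrite (_ : _ + _ = 0) ?scale0r // invrN expr2 mulrA.
  rewrite [(_ * _ * _)^-1]invfM mulfVK //.
  by rewrite addNr.
have Ps : (1%:M - N%:R^-1 *: J)^T = 1%:M - N%:R^-1 *: J.
  by rewrite linearB linearZ /= trmx1 trmx_const.
apply/and4P; split; rewrite ?LY ?YL ?Ps //; apply/eqP.
- by rewrite mulmxBl mul1mx -scalemxAl difference_matrix_Jmul scaler0 subr0.
(* Regrouping [Y L Y] moves the projection to the right of [Y], where [YJ] applies. *)
- by rewrite -YL -mulmxA LY mulmxBr mulmx1 -scalemxAr YJ scaler0 subr0.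
Qed.

End Shift.

Theorem theorem2p1 (R : realType) (N : nat) (L : 'M[R]_N) :
  (1 <= N)%N ->
  difference_matrix L ->
  let J : 'M[R]_N := const_mx 1 in
  let rhs (tau : R) : 'M[R]_N :=
    invmx (L - tau *: J) + (tau * N%:R ^+ 2)^-1 *: J in
  [/\ forall tau : R, tau != 0 ->
        L - tau *: J \in unitmx /\ moore_penrose L = rhs tau,
      forall tau1 tau2 : R, tau1 != 0 -> tau2 != 0 -> rhs tau1 = rhs tau2 &
      (moore_penrose L)^T = moore_penrose L].
Proof.
move=> N_gt0 dL J rhs.
have mpE tau : tau != 0 -> moore_penrose L = rhs tau.
  by move=> tau0; apply/moore_penroseP/difference_matrix_moore_penrose.
split=> [tau tau0|tau1 tau2 tau10 tau20|].
- by split; [apply: shift_unitmx | apply: mpE].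
- by rewrite -mpE // (mpE tau2).
- by rewrite moore_penrose_tr; case: dL => ->.
Qed.
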